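(* Let $(\mathcal{A},[\cdot,\cdot]_{\mathcal{A}},N_{\mathcal{A}})$ and $(\mathcal{A}',[\cdot,\cdot]_{\mathcal{A}'},N_{\mathcal{A}'})$ be two Nijenhuis mock-Lie algebras, and let $\rho_{\mathcal{A}}:\mathcal{A}\to\mathrm{End}(\mathcal{A}')$, $\rho_{\mathcal{A}'}:\mathcal{A}'\to\mathrm{End}(\mathcal{A})$ be linear maps. Define on $\mathcal{A}\oplus\mathcal{A}'$, for $a,b\in\mathcal{A}$ and $x,y\in\mathcal{A}'$, $$[a+x,b+y]_\diamond=[a,b]_{\mathcal{A}}+\rho_{\mathcal{A}'}(y)a+\rho_{\mathcal{A}'}(x)b+[x,y]_{\mathcal{A}'}+\rho_{\mathcal{A}}(a)y+\rho_{\mathcal{A}}(b)x,$$ $$(N_{\mathcal{A}}+N_{\mathcal{A}'})(a+x)=N_{\mathcal{A}}(a)+N_{\mathcal{A}'}(x).$$ Then $((\mathcal{A},N_{\mathcal{A}}),(\mathcal{A}',N_{\mathcal{A}'}),\rho_{\mathcal{A}},\rho_{\mathcal{A}'})$ is a matched pair of the Nijenhuis mock-Lie algebras $(\mathcal{A},[\cdot,\cdot]_{\mathcal{A}},N_{\mathcal{A}})$ and $(\mathcal{A}',[\cdot,\cdot]_{\mathcal{A}'},N_{\mathcal{A}'})$ if and only if $(\mathcal{A}\oplus\mathcal{A}',[\cdot,\cdot]_\diamond,N_{\mathcal{A}}+N_{\mathcal{A}'})$ is a Nijenhuis mock-Lie algebra.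
   Context: All vector spaces are over a field $K$ of characteristic zero. A mock-Lie algebra $(\mathcal{A},[\cdot,\cdot])$ is a vector space with a commutative bilinear map $[\cdot,\cdot]$ such that $[x,[y,z]]+[y,[z,x]]+[z,[x,y]]=0$. A Nijenhuis mock-Lie algebra $(\mathcal{A},[\cdot,\cdot],N)$ is a mock-Lie algebra with a linear map $N$ such that $[N(x),N(y)]+N^2([x,y])=N([N(x),y])+N([x,N(y)])$. A representation of a mock-Lie algebra $(\mathcal{A},[\cdot,\cdot])$ is a pair $(V,\rho)$ with $\rho:\mathcal{A}\to\mathrm{End}(V)$ linear and $\rho([x,y])v=-\rho(x)(\rho(y)v)-\rho(y)(\rho(x)v)$. A representation of $(\mathcal{A},[\cdot,\cdot],N)$ is a triple $(V,\rho,\alpha)$ with $(V,\rho)$ a representation of $(\mathcal{A},[\cdot,\cdot])$ and $\alpha:V\to V$ linear with $\rho(N(x))\alpha(v)+\alpha^2(\rho(x)v)=\alpha(\rho(N(x))v)+\alpha(\rho(x)\alpha(v))$. $(\mathcal{A},\mathcal{A}',\rho_{\mathcal{A}},\rho_{\mathcal{A}'})$ is a matched pair of mock-Lie algebras if $(\mathcal{A}',\rho_{\mathcal{A}})$ is a representation of $\mathcal{A}$, $(\mathcal{A},\rho_{\mathcal{A}'})$ is a representation of $\mathcal{A}'$, and for all $a,b\in\mathcal{A}$, $x,y\in\mathcal{A}'$ $$\rho_{\mathcal{A}}(a)[x,y]_{\mathcal{A}'}+[\rho_{\mathcal{A}}(a)x,y]_{\mathcal{A}'}+[x,\rho_{\mathcal{A}}(a)y]_{\mathcal{A}'}+\rho_{\mathcal{A}}(\rho_{\mathcal{A}'}(y)a)x+\rho_{\mathcal{A}}(\rho_{\mathcal{A}'}(x)a)y=0,$$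 $$\rho_{\mathcal{A}'}(x)[a,b]_{\mathcal{A}}+[\rho_{\mathcal{A}'}(x)a,b]_{\mathcal{A}}+[a,\rho_{\mathcal{A}'}(x)b]_{\mathcal{A}}+\rho_{\mathcal{A}'}(\rho_{\mathcal{A}}(b)x)a+\rho_{\mathcal{A}'}(\rho_{\mathcal{A}}(a)x)b=0.$$ $((\mathcal{A},N_{\mathcal{A}}),(\mathcal{A}',N_{\mathcal{A}'}),\rho_{\mathcal{A}},\rho_{\mathcal{A}'})$ is a matched pair of Nijenhuis mock-Lie algebras if $(\mathcal{A},\mathcal{A}',\rho_{\mathcal{A}},\rho_{\mathcal{A}'})$ is a matched pair of mock-Lie algebras, $(\mathcal{A}',\rho_{\mathcal{A}},N_{\mathcal{A}'})$ is a representation of $(\mathcal{A},[\cdot,\cdot]_{\mathcal{A}},N_{\mathcal{A}})$, and $(\mathcal{A},\rho_{\mathcal{A}'},N_{\mathcal{A}})$ is a representation of $(\mathcal{A}',[\cdot,\cdot]_{\mathcal{A}'},N_{\mathcal{A}'})$. *)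

(* Defs.v *)
From mathcomp Require Import all_boot all_order all_algebra.

Set Implicit Arguments.
Unset Strict Implicit.
Unset Printing Implicit Defensive.

Import GRing.Theory.
Local Open Scope ring_scope.

(* Vector spaces are lmodTypes over a field, hence of arbitrary dimension.    *)
(* The structures below are predicates on bare functions, so that linearity   *)
(* of the brackets, operators and actions is part of each predicate.          *)

Record mock_lie (K : fieldType) (A : lmodType K) (br : A -> A -> A) : Prop :=
  MockLie {
    mock_lie_linearl : forall y, linear (br^~ y);
    mock_lie_linearr : forall x, linear (br x);
    mock_lieC : forall x y, br x y = br y x;
    mock_lie_jacobi : forall x y z,
      br x (br y z) + br y (br z x) + br z (br x y) = 0
  }.

Record nijenhuis_mock_lie (K : fieldType) (A : lmodType K)
    (br : A -> A -> A) (N : A -> A) : Prop :=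
  NijenhuisMockLie {
    nijenhuis_mock_lie_algebra : mock_lie br;
    nijenhuis_linear : linear N;
    nijenhuis_identity : forall x y,
      br (N x) (N y) + N (N (br x y)) = N (br (N x) y) + N (br x (N y))
  }.

(* rho is a linear map A -> End(V), uncurried since the type                  *)
(* {linear V -> V} carries no lmodType structure.                             *)
Record linear_to_End (K : fieldType) (A V : lmodType K)
    (rho : A -> V -> V) : Prop :=
  LinearToEnd {
    linear_to_End_val : forall x, linear (rho x);
    linear_to_End_linear : forall v, linear (rho^~ v)
  }.

(* The algebra axioms on br are not repeated in the next four predicates:     *)
(* they are only meaningful when br (and N) satisfy them.                     *)
Record mock_lie_rep (K : fieldType) (A V : lmodType K)
    (br : A -> A -> A) (rho : A -> V -> V) : Prop :=
  MockLieRep {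
    mock_lie_rep_linear : linear_to_End rho;
    mock_lie_rep_br : forall x y v,
      rho (br x y) v = - rho x (rho y v) - rho y (rho x v)
  }.

Record nijenhuis_rep (K : fieldType) (A V : lmodType K)
    (br : A -> A -> A) (N : A -> A)
    (rho : A -> V -> V) (alpha : V -> V) : Prop :=
  NijenhuisRep {
    nijenhuis_rep_rep : mock_lie_rep br rho;
    nijenhuis_rep_linear : linear alpha;
    nijenhuis_rep_identity : forall x v,
      rho (N x) (alpha v) + alpha (alpha (rho x v))
        = alpha (rho (N x) v) + alpha (rho x (alpha v))
  }.

Record matched_pair (K : fieldType) (A A' : lmodType K)
    (brA : A -> A -> A) (brA' : A' -> A' -> A')
    (rhoA : A -> A' -> A') (rhoA' : A' -> A -> A) : Prop :=
  MatchedPair {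
    matched_pair_repl : mock_lie_rep brA rhoA;
    matched_pair_repr : mock_lie_rep brA' rhoA';
    matched_pair_compatl : forall a x y,
      rhoA a (brA' x y) + brA' (rhoA a x) y + brA' x (rhoA a y)
        + rhoA (rhoA' y a) x + rhoA (rhoA' x a) y = 0;
    matched_pair_compatr : forall x a b,
      rhoA' x (brA a b) + brA (rhoA' x a) b + brA a (rhoA' x b)
        + rhoA' (rhoA b x) a + rhoA' (rhoA a x) b = 0
  }.

Record nijenhuis_matched_pair (K : fieldType) (A A' : lmodType K)
    (brA : A -> A -> A) (NA : A -> A)
    (brA' : A' -> A' -> A') (NA' : A' -> A')
    (rhoA : A -> A' -> A') (rhoA' : A' -> A -> A) : Prop :=
  NijenhuisMatchedPair {
    nijenhuis_matched_pair_pair : matched_pair brA brA' rhoA rhoA';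
    nijenhuis_matched_pair_repl : nijenhuis_rep brA NA rhoA NA';
    nijenhuis_matched_pair_repr : nijenhuis_rep brA' NA' rhoA' NA
  }.

Definition diamond (K : fieldType) (A A' : lmodType K)
    (brA : A -> A -> A) (brA' : A' -> A' -> A')
    (rhoA : A -> A' -> A') (rhoA' : A' -> A -> A)
    (u v : (A * A')%type) : (A * A')%type :=
  (brA u.1 v.1 + rhoA' v.2 u.1 + rhoA' u.2 v.1,
   brA' u.2 v.2 + rhoA u.1 v.2 + rhoA v.1 u.2).

Definition sum_operator (K : fieldType) (A A' : lmodType K)
    (NA : A -> A) (NA' : A' -> A') (u : (A * A')%type) : (A * A')%type :=
  (NA u.1, NA' u.2).

(* Main.v *)
Require Import Defs.
From mathcomp Require Import all_boot all_order all_algebra.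

Set Implicit Arguments.
Unset Strict Implicit.
Unset Printing Implicit Defensive.

Local Open Scope ring_scope.

Import GRing.Theory.

(** Each axiom of the diamond algebra is an identity in [A * A'] that is
    additive in every argument, and its first component splits along the
    homogeneous parts of the arguments.  For arguments [a + x], [b + y], [c + z]
    the [A]-part of the Jacobi sum is the sum of
    - the Jacobi sum of [a], [b], [c] in [A];
    - one term for each choice of an element of [A'] and two elements of [A],
      which is the left-hand side of the compatibility condition of a matched
      pair;
    - one term for each choice of two elements of [A'] and one of [A], which is
      the failure of [rhoA'] to be a representation.
    This is [jacobiator_diamond1].  Likewise the [A]-parts of the two sides of
    the Nijenhuis identity split into those of [A] at [(a, b)] and those of the
    identity for a representation at [(x, b)] and [(y, a)].  So the matched pair
    conditions make the [A]-parts hold, and conversely each condition is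
    recovered by evaluating at homogeneous arguments, all other terms being
    zero.  Exchanging [A] and [A'] exchanges the two components of the diamond
    bracket, so the [A']-parts are given by the same lemmas.  Commutativity and
    bilinearity of the diamond bracket are automatic. *)

Lemma linear_add (K : fieldType) (U V : lmodType K) (f : U -> V) :
  linear f -> {morph f : u v / u + v}.
Proof. by move=> lf u v; have := lf 1 u v; rewrite !scale1r. Qed.

Lemma linear_zero (K : fieldType) (U V : lmodType K) (f : U -> V) :
  linear f -> f 0 = 0.
Proof.
by move=> lf; apply: (addrI (f 0)); rewrite -linear_add // !addr0.
Qed.

Lemma diamondC (K : fieldType) (A A' : lmodType K)
    (brA : A -> A -> A) (brA' : A' -> A' -> A')
    (rhoA : A -> A' -> A') (rhoA' : A' -> A -> A) :
  commutative brA -> commutative brA' ->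
  commutative (diamond brA brA' rhoA rhoA').
Proof.
move=> CA CA' u v; rewrite /diamond CA CA'.
by congr (_, _); rewrite addrAC.
Qed.

Lemma diamond_linearr (K : fieldType) (A A' : lmodType K)
    (brA : A -> A -> A) (brA' : A' -> A' -> A')
    (rhoA : A -> A' -> A') (rhoA' : A' -> A -> A) :
  mock_lie brA -> mock_lie brA' -> linear_to_End rhoA -> linear_to_End rhoA' ->
  forall u, linear (diamond brA brA' rhoA rhoA' u).
Proof.
move=> [_ lA _ _] [_ lA' _ _] [rA rA1] [rA' rA'1] [a x] k [b y] [c z].
rewrite /diamond /=; congr (_, _) => /=.
  by rewrite lA rA' (rA'1 a k y z) !scalerDr !addrA (ACl (1*3*5*2*4*6)).
by rewrite lA' rA (rA1 x k b c) !scalerDr !addrA (ACl (1*3*5*2*4*6)).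
Qed.

Definition jacobiator (K : fieldType) (A : lmodType K) (br : A -> A -> A)
    (x y z : A) : A :=
  br x (br y z) + br y (br z x) + br z (br x y).

Definition rep_defect (K : fieldType) (A V : lmodType K)
    (br : A -> A -> A) (rho : A -> V -> V) (x y : A) (v : V) : V :=
  rho (br x y) v + rho x (rho y v) + rho y (rho x v).

Definition compat_defect (K : fieldType) (A A' : lmodType K)
    (brA : A -> A -> A) (rhoA : A -> A' -> A') (rhoA' : A' -> A -> A)
    (x : A') (a b : A) : A :=
  rhoA' x (brA a b) + brA (rhoA' x a) b + brA a (rhoA' x b)
    + rhoA' (rhoA b x) a + rhoA' (rhoA a x) b.

Lemma mock_lie_repE (K : fieldType) (A V : lmodType K)
    (br : A -> A -> A) (rho : A -> V -> V) :
  mock_lie_rep br rho <->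
  linear_to_End rho /\ forall x y v, rep_defect br rho x y v = 0.
Proof.
split=> [[lin brE] | [lin brE]]; split=> // x y v.
  by rewrite /rep_defect brE addrAC subrK addNr.
apply/eqP; rewrite -subr_eq0 opprD !opprK addrA.
by apply/eqP/brE.
Qed.

(** The symmetry between [A] and [A'], which turns a statement on first
    components into one on second components. *)
Lemma diamond_swap (K : fieldType) (A A' : lmodType K)
    (brA : A -> A -> A) (brA' : A' -> A' -> A')
    (rhoA : A -> A' -> A') (rhoA' : A' -> A -> A) (u v : A * A') :
  diamond brA' brA rhoA' rhoA (swap_pair u) (swap_pair v) =
  swap_pair (diamond brA brA' rhoA rhoA' u v).
Proof. by congr (_, _); rewrite addrAC. Qed.

(** Expanding by linearity gives 9 terms for each of the 3 nested brackets, and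
    they regroup as 1 * 3 + 3 * 5 + 3 * 3.  Nested brackets produce [rhoA' x b]
    only in the second slot of [brA], while [compat_defect] has it in the first
    slot as well: this is where commutativity of [brA] enters. *)
Lemma jacobiator_diamond1 (K : fieldType) (A A' : lmodType K)
    (brA : A -> A -> A) (brA' : A' -> A' -> A')
    (rhoA : A -> A' -> A') (rhoA' : A' -> A -> A) (u v w : A * A') :
  mock_lie brA -> linear_to_End rhoA' ->
  (jacobiator (diamond brA brA' rhoA rhoA') u v w).1 =
  jacobiator brA u.1 v.1 w.1
  + (compat_defect brA rhoA rhoA' u.2 v.1 w.1
     + compat_defect brA rhoA rhoA' v.2 w.1 u.1
     + compat_defect brA rhoA rhoA' w.2 u.1 v.1)
  + (rep_defect brA' rhoA' v.2 w.2 u.1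
     + rep_defect brA' rhoA' w.2 u.2 v.1
     + rep_defect brA' rhoA' u.2 v.2 w.1).
Proof.
move=> [_ lA CA _] [rA' rA'1]; case: u v w => [a x] [b y] [c z].
have brD p := linear_add (lA p); have rhoD p := linear_add (rA' p).
have rhoDl p q r : rhoA' (p + q) r = rhoA' p r + rhoA' q r.
  exact: (linear_add (rA'1 r)).
rewrite /jacobiator /compat_defect /rep_defect /= !brD !rhoDl !rhoD !addrA.
rewrite (CA (rhoA' x b) c) (CA (rhoA' y c) a) (CA (rhoA' z a) b).
(* The 27 terms are grouped as 3 for the Jacobi sum, three times 5 for the
   compatibility terms and three times 3 for the representation terms. *)
by rewrite [LHS](ACl (1*10*19
  *(7*21*11*14*24)*(16*3*20*23*6)*(25*12*2*5*15)
  *(4*18*26)*(13*27*8)*(22*9*17))) /= !addrA.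
Qed.

(** The three summands of [jacobiator_diamond1] are separated by the number of
    arguments in [A'], namely 0, 1 and 2. *)
Lemma jacobi_diamond1P (K : fieldType) (A A' : lmodType K)
    (brA : A -> A -> A) (brA' : A' -> A' -> A')
    (rhoA : A -> A' -> A') (rhoA' : A' -> A -> A) :
  mock_lie brA -> mock_lie brA' -> linear_to_End rhoA -> linear_to_End rhoA' ->
  (forall u v w, (jacobiator (diamond brA brA' rhoA rhoA') u v w).1 = 0) <->
  (forall x y a, rep_defect brA' rhoA' x y a = 0) /\
  (forall x a b, compat_defect brA rhoA rhoA' x a b = 0).
Proof.
move=> mA mA' lrho lrho'; have [lAl lA _ jA] := mA; have [lA'l lA' _ _] := mA'.
have [rA rA1] := lrho; have [rA' rA'1] := lrho'.
have br0 p := linear_zero (lA p).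
have br0l p : brA 0 p = 0 := linear_zero (lAl p).
have br'0 p := linear_zero (lA' p).
have br'0l p : brA' 0 p = 0 := linear_zero (lA'l p).
have rho0 p := linear_zero (rA p).
have rho0l p : rhoA 0 p = 0 := linear_zero (rA1 p).
have rho'0 p := linear_zero (rA' p).
have rho'0l p : rhoA' 0 p = 0 := linear_zero (rA'1 p).
pose z0 := (br0, br0l, br'0, br'0l, rho0, rho0l, rho'0, rho'0l, addr0, add0r).
split=> [J0 | [R0 C0] u v w]; last first.
  by rewrite jacobiator_diamond1 // !R0 !C0 /jacobiator jA !addr0.
split=> [x y a | x a b].
  have := J0 (a, 0) (0, x) (0, y); rewrite jacobiator_diamond1 //=.
  by rewrite /jacobiator /compat_defect /rep_defect !z0.
have := J0 (0, x) (a, 0) (b, 0); rewrite jacobiator_diamond1 //=.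
by rewrite /jacobiator /compat_defect /rep_defect !z0.
Qed.

(** The term [brA' u.2 v.2] contributes only to the second component, so the
    first one involves [rhoA'] linearly: the single choice of [u] in [A'] and
    [v] in [A] gives the whole identity for the representation. *)
Lemma nijenhuis_diamond1P (K : fieldType) (A A' : lmodType K)
    (brA : A -> A -> A) (NA : A -> A)
    (brA' : A' -> A' -> A') (NA' : A' -> A')
    (rhoA : A -> A' -> A') (rhoA' : A' -> A -> A)
    (br := diamond brA brA' rhoA rhoA') (N := sum_operator NA NA') :
  nijenhuis_mock_lie brA NA -> linear NA' -> linear_to_End rhoA' ->
  (forall u v,
     (br (N u) (N v) + N (N (br u v))).1 = (N (br (N u) v) + N (br u (N v))).1)
  <->
  (forall x a, rhoA' (NA' x) (NA a) + NA (NA (rhoA' x a))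
     = NA (rhoA' (NA' x) a) + NA (rhoA' x (NA a))).
Proof.
rewrite {}/br {}/N => -[[lAl lA _ _] lN nijA] lN' [rA' rA'1].
have ND := linear_add lN.
split=> [nij x b | nij [a x] [b y]] /=; last first.
  rewrite !ND !addrA [LHS](ACl (1*4*(2*5)*(3*6))) /= nijA !nij !addrA.
  by rewrite [LHS](ACl (1*4*5*2*3*6)).
have br0 p : brA 0 p = 0 := linear_zero (lAl p).
have rho0 p := linear_zero (rA' p).
have rho0l p : rhoA' 0 p = 0 := linear_zero (rA'1 p).
have := nij (0, x) (b, 0).
by rewrite /= !(linear_zero lN, linear_zero lN', br0, rho0, rho0l, add0r).
Qed.

Theorem theorem4p3 (K : fieldType) (char0 : [pchar K] =i pred0)
    (A A' : lmodType K)
    (brA : A -> A -> A) (NA : A -> A)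
    (brA' : A' -> A' -> A') (NA' : A' -> A')
    (hA : nijenhuis_mock_lie brA NA) (hA' : nijenhuis_mock_lie brA' NA')
    (rhoA : A -> A' -> A') (rhoA' : A' -> A -> A)
    (hrhoA : linear_to_End rhoA) (hrhoA' : linear_to_End rhoA') :
  nijenhuis_matched_pair brA NA brA' NA' rhoA rhoA' <->
  nijenhuis_mock_lie (A := (A * A')%type)
    (diamond brA brA' rhoA rhoA') (sum_operator NA NA').
Proof.
have [mA lN _] := hA; have [mA' lN' _] := hA'.
have J1 := jacobi_diamond1P mA mA' hrhoA hrhoA'.
have J2 := jacobi_diamond1P mA' mA hrhoA' hrhoA.
have N1 := nijenhuis_diamond1P brA' rhoA hA lN' hrhoA'.
have N2 := nijenhuis_diamond1P brA rhoA' hA' lN hrhoA.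
(* The [A']-parts, transported along the exchange of [A] and [A']. *)
have swapJ u v w : (jacobiator (diamond brA brA' rhoA rhoA') u v w).2 =
    (jacobiator (diamond brA' brA rhoA' rhoA)
      (swap_pair u) (swap_pair v) (swap_pair w)).1.
  by rewrite /jacobiator !diamond_swap.
have swapN u : sum_operator NA' NA (swap_pair u) =
  swap_pair (sum_operator NA NA' u) by [].
split.
  case=> -[/mock_lie_repE[_ R2] /mock_lie_repE[_ R1] C2 C1] [_ _ n2] [_ _ n1].
  have {R1 C1} J1 := J1.2 (conj R1 C1).
  have {R2 C2} J2 := J2.2 (conj R2 C2).
  have {n1} N1 := N1.2 n1; have {n2} N2 := N2.2 n2.
  have lr := diamond_linearr mA mA' hrhoA hrhoA'.
  have C := diamondC rhoA rhoA' (mock_lieC mA) (mock_lieC mA').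
  split; first split=> //.
  - by move=> v k u w; rewrite !(C _ v) lr.
  - move=> u v w; apply/pair_equal_spec.
    by split; [exact: J1 | exact: etrans (swapJ u v w) (J2 _ _ _)].
  - by move=> k u v; rewrite /sum_operator /= lN lN'.
  - move=> u v; apply/pair_equal_spec.
    split; first exact: N1.
    have := N2 (swap_pair u) (swap_pair v).
    by rewrite !(swapN, diamond_swap).
case=> -[_ _ _ jac] _ nij.
have [|R1 C1] := J1.1; first by move=> u v w; rewrite /jacobiator jac.
have [|R2 C2] := J2.1.
  move=> [x a] [y b] [z c].
  by rewrite -(swapJ (a, x) (b, y) (c, z)) /jacobiator jac.
have rep1 := (mock_lie_repE brA' rhoA').2 (conj hrhoA' R1).
have rep2 := (mock_lie_repE brA rhoA).2 (conj hrhoA R2).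
split; first by split.
- split=> //; apply: N2.1 => -[x a] [y b].
  have := congr1 snd (nij (a, x) (b, y)).
  rewrite -[(x, a)]/(swap_pair (a, x)) -[(y, b)]/(swap_pair (b, y)).
  by rewrite !(swapN, diamond_swap).
- split=> //; apply: N1.1 => u v; exact: (congr1 fst (nij u v)).
Qed.
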